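(* Let $A\in\mathcal{S}_{N,p}$ be a symmetric $p$-semiseparable matrix with Givens-vector representation $\boldsymbol c_i,\boldsymbol s_i,\hat{\boldsymbol\nu}_i\in\mathbb{R}^p$ ($i=1,\dots,N$), let $S_i=\operatorname{diag}(\boldsymbol s_i)$, and let $D=\operatorname{diag}(d_1,\dots,d_N)$. Suppose $A+D$ is positive definite, and let $L$ be the Cholesky factor of $A+D=LL^T$, written as $$L(i,j)=\begin{cases}\boldsymbol c_i^T\,S^{>}_{i-1:j}\,\boldsymbol w_j,&1\le j<i\le N,\\ f_i,&1\le i=j\le N,\end{cases}$$ with $f_i\in\mathbb{R}$ and $\boldsymbol w_i\in\mathbb{R}^p$ given by the recursion in the context. If $f_i>0$ and $d_i>0$ for all $i=1,\dots,N$, then $L^{-1}$ (which is lower triangular) can be represented by $$L^{-1}(i,j)=\begin{cases}\bar{\boldsymbol c}_i^T\,\bar S^{>}_{i-1:j}\,\bar{\boldsymbol w}_j,&1\le j<i\le N,\\ \bar f_i,&1\le i=j\le N,\end{cases}$$ where $$\bar{\boldsymbol c}_i=-f_i^{-1}\boldsymbol c_i,\qquad \bar f_i=f_i^{-1}\qquad(i=1,\dots,N),$$ $$\bar S_i=S_i(I_p-\boldsymbol w_if_i^{-1}\boldsymbol c_i^T),\qquad \bar{\boldsymbol w}_i=f_i^{-1}(I_p-\boldsymbol w_if_i^{-1}\boldsymbol c_i^T)^{-1}\boldsymbol w_i\qquad(i=1,\dots,N-1),$$ the inverses appearing here being well defined.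
   Context: For a sequence of $p\times p$ matrices, $S^{>}_{i:j}=S_iS_{i-1}\cdots S_j$ for $i\ge j$ and $S^{>}_{i:j}=I_p$ for $i<j$; similarly for $\bar S^{>}_{i:j}$. Definition of $\mathcal{S}_{N,p}$: a symmetric matrix $A\in\mathbb{R}^{N\times N}$ is $p$-semiseparable ($A\in\mathcal{S}_{N,p}$) if $\operatorname{rank}(A(i:N,1:i))\le p$ for all $i=1,\dots,N$, with equality for at least one $i$. Here $A(i:N,1:i)$ is the submatrix of rows $i,\dots,N$ and columns $1,\dots,i$. Givens-vector representation (GvR): vectors $\boldsymbol c_i,\boldsymbol s_i,\hat{\boldsymbol\nu}_i\in\mathbb{R}^p$ ($i=1,\dots,N$), with components $c_{i,k},s_{i,k},\hat\nu_{i,k}$, form a GvR of a symmetric $A$ if $c_{i,k}^2+s_{i,k}^2=1$ for all $i\le N-1$, $k\le p$, with the convention $c_{N,k}=1$, $s_{N,k}=0$, and, with $S_i=\operatorname{diag}(\boldsymbol s_i)$, $A(i,j)=\boldsymbol c_i^TS^{>}_{i-1:j}\hat{\boldsymbol\nu}_j$ for $1\le j\le i\le N$ (entries above the diagonal by symmetry). Recursion for the Cholesky factor of $A+D$: $f_i=\sqrt{\boldsymbol c_i^T(\hat{\boldsymbol\nu}_i-P_i\boldsymbol c_i)+d_i}$ for $i=1,\dots,N$ and $\boldsymbol w_i=(\hat{\boldsymbol\nu}_i-P_i\boldsymbol c_i)/f_i$ for $i=1,\dots,N-1$, with $P_1=\boldsymbol 0_{p\times p}$ and $P_i=S_{i-1}(\boldsymbol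 w_{i-1}\boldsymbol w_{i-1}^T+P_{i-1})S_{i-1}$ for $i=2,\dots,N$. These are known to give the entries of $L$ as displayed in the claim. *)

(* Defs.v *)
From HB Require Import structures.
From mathcomp Require Import all_boot all_order all_algebra.
From mathcomp Require Import reals.
Set Implicit Arguments.
Unset Strict Implicit.
Unset Printing Implicit Defensive.
Import Order.TTheory GRing.Theory Num.Theory.
Local Open Scope ring_scope.

(* Indices are 0-based: i : 'I_N stands for the index i + 1 of 1, ..., N. *)

Section Definitions.
Variables (R : realType) (N p : nat).
Implicit Types (A L M : 'M[R]_N) (S P : 'I_N -> 'M[R]_p).
Implicit Types (c s nu w : 'I_N -> 'cV[R]_p) (d f : 'I_N -> R).

(* A(i:N, 1:i); enum_val lists the elements of a set of ordinals in
   increasing order. *)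
Definition lower_left_submx A (i : 'I_N) :
    'M[R]_(#|[set k : 'I_N | (i <= k)%N]|, #|[set k : 'I_N | (k <= i)%N]|) :=
  mxsub (fun k => enum_val k) (fun l => enum_val l) A.

Definition semiseparable A : Prop :=
  [/\ A \is symmetricmx,
      forall i : 'I_N, (\rank (lower_left_submx A i) <= p)%N
    & exists i : 'I_N, \rank (lower_left_submx A i) = p].

(* S_{i-1} S_{i-2} ... S_j, the identity if i <= j: this is S^>_{i-1:j},
   stated with the exclusive bound i to avoid the predecessor of 0. *)
Definition dec_prod S (i j : 'I_N) : 'M[R]_p :=
  \big[mulmx/1%:M]_(k <- rev (enum 'I_N) | (j <= k < i)%N) S k.

Definition diag_of s (i : 'I_N) : 'M[R]_p := diag_mx (s i)^T.

Definition givens_vector_rep A c s nu : Prop :=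
  [/\ forall (i : 'I_N) (k : 'I_p), (i.+1 < N)%N ->
        c i k 0 ^+ 2 + s i k 0 ^+ 2 = 1,
      forall (i : 'I_N) (k : 'I_p), i.+1 = N -> c i k 0 = 1 /\ s i k 0 = 0
    & forall i j : 'I_N, (j <= i)%N ->
        A i j = ((c i)^T *m dec_prod (diag_of s) i j *m nu j) 0 0].

Definition posdefmx M : Prop :=
  M \is symmetricmx /\
  forall x : 'cV[R]_N, x != 0 -> 0 < (x^T *m M *m x) 0 0.

Definition cholesky_factor M L : Prop :=
  [/\ is_trig_mx L, forall i : 'I_N, 0 < L i i & M = L *m L^T].

(* The last vector w_N is not constrained, since the recursion only produces
   w_1, ..., w_{N-1}. *)
Definition cholesky_recursion c s nu d f w P : Prop :=
  [/\ forall i : 'I_N, i = 0%N :> nat -> P i = 0,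
      forall i j : 'I_N, j = i.+1 :> nat ->
        P j = diag_of s i *m (w i *m (w i)^T + P i) *m diag_of s i,
      forall i : 'I_N,
        f i = Num.sqrt (((c i)^T *m (nu i - P i *m c i)) 0 0 + d i)
    & forall i : 'I_N, (i.+1 < N)%N ->
        w i = (f i)^-1 *: (nu i - P i *m c i)].

(* Only S_1, ..., S_{N-1} and w_1, ..., w_{N-1} occur here. *)
Definition lower_tri_rep L c S w f : Prop :=
  [/\ is_trig_mx L,
      forall i j : 'I_N, (j < i)%N ->
        L i j = ((c i)^T *m dec_prod S i j *m w j) 0 0
    & forall i : 'I_N, L i i = f i].

(* I_p - w_i f_i^{-1} c_i^T *)
Definition elim_mx c w f (i : 'I_N) : 'M[R]_p :=
  1%:M - w i *m ((f i)^-1 *: (c i)^T).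

Definition c_bar c f (i : 'I_N) : 'cV[R]_p := - (f i)^-1 *: c i.

Definition f_bar f (i : 'I_N) : R := (f i)^-1.

Definition S_bar c s w f (i : 'I_N) : 'M[R]_p :=
  diag_of s i *m elim_mx c w f i.

Definition w_bar c w f (i : 'I_N) : 'cV[R]_p :=
  (f i)^-1 *: (invmx (elim_mx c w f i) *m w i).

End Definitions.

Arguments semiseparable {R N} p A.

(* Main.v *)
(** Forward substitution on [L x = e_j] only involves the state vector
    [x_i = \sum_(k < i) L^{-1}(k, j) S^>_{i-1:k} w_k], which obeys
    [x_{i+1} = S_i (x_i + L^{-1}(i, j) w_i)].  For [i > j] one has
    [L^{-1}(i, j) = - f_i^{-1} c_i^T x_i], so the recursion becomes
    [x_{i+1} = S_i (I - w_i f_i^{-1} c_i^T) x_i], and it starts from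
    [x_{j+1} = f_j^{-1} S_j w_j].  The matrix [I - w_i f_i^{-1} c_i^T] is
    invertible because [f_i^2 = f_i c_i^T w_i + d_i] with [d_i > 0], so that
    [1 - f_i^{-1} c_i^T w_i = d_i / f_i^2]. *)

Require Import Defs.
From HB Require Import structures.
From mathcomp Require Import all_boot all_order all_algebra.
From mathcomp Require Import reals.
Set Implicit Arguments.
Unset Strict Implicit.
Unset Printing Implicit Defensive.
Import Order.TTheory GRing.Theory Num.Theory.
Local Open Scope ring_scope.

Lemma dec_prod_id (R : realType) (N p : nat) (S : 'I_N -> 'M[R]_p) (i : 'I_N) :
  dec_prod S i i = 1%:M.
Proof. by rewrite /dec_prod big_pred0 // => k; case: ltngtP. Qed.

(** Both products run over strictly decreasing lists with the same elements, and a strictly sorted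
    list is determined by its elements. *)
Lemma dec_prodS (R : realType) (N p : nat) (S : 'I_N -> 'M[R]_p)
    (i i' j : 'I_N) :
  i' = i.+1 :> nat -> (j <= i)%N ->
  dec_prod S i' j = S i *m dec_prod S i j.
Proof.
move=> i'E le_ji; pose gt_ord := [rel a b : 'I_N | (b < a)%N].
have gt_trans : transitive gt_ord.
  by move=> y x z /= xy zy; apply: ltn_trans zy xy.
have gt_irr : irreflexive gt_ord by move=> x /=; rewrite ltnn.
have enum_sorted : sorted gt_ord (rev (enum 'I_N)).
  rewrite rev_sorted /=; have := iota_ltn_sorted 0 N.
  by rewrite -val_enum_ord sorted_map.
rewrite /dec_prod -big_filter -[in RHS]big_filter -(big_cons _ _ i _ xpredT S).
congr (bigop.body _ _ _). apply: (irr_sorted_eq gt_trans gt_irr).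
- exact: sorted_filter.
- rewrite /= path_sortedE // sorted_filter // andbT.
  by apply/allP => k; rewrite mem_filter => /andP[/andP[]].
- move=> k; rewrite inE !mem_filter mem_rev mem_enum !andbT i'E.
  rewrite ltnS -val_eqE /=.
  by case: (ltngtP k i) => [_|_|->]; rewrite ?andbF ?andbT.
Qed.

Lemma mulmx_col11 (F : comNzRingType) (p : nat) (u : 'cV[F]_p) (a : 'M[F]_1) :
  u *m a = a 0 0 *: u.
Proof. by rewrite {1}[a]mx11_scalar mul_mx_scalar. Qed.

(** Sherman-Morrison: since [u v^T] squares to [(v^T u) u v^T], the inverse is [1 + t^-1 u v^T] with
    [t = 1 - v^T u]. *)
Lemma unitmx_sub_rank1 (F : fieldType) (p : nat) (u v : 'cV[F]_p) :
  (v^T *m u) 0 0 != 1 -> 1%:M - u *m v^T \in unitmx.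
Proof.
move=> vu; have t0 : 1 - (v^T *m u) 0 0 != 0 by rewrite subr_eq0 eq_sym.
set t := _ - _ in t0.
suff /mulmx1_unit[] :
  (1%:M - u *m v^T) *m (1%:M + t^-1 *: (u *m v^T)) = 1%:M by [].
have sq : (u *m v^T) *m (u *m v^T) = (1 - t) *: (u *m v^T).
  rewrite mulmxA -[u *m v^T *m u]mulmxA mulmx_col11.
  by rewrite -scalemxAl /t subKr.
rewrite mulmxDr mulmx1 -scalemxAr mulmxBl mul1mx sq.
rewrite -[X in X - (1 - t) *: _]scale1r.
by rewrite -scalerBl subKr scalerA mulVf // scale1r subrK.
Qed.

(** The purely algebraic core, for arbitrary matrices [S i]: the claimed inverse is built entrywise
    as [M], and checking [L *m M = 1] gives both conclusions. *)
Lemma lower_tri_rep_inv (R : realType) (N p : nat) (L : 'M[R]_N)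
    (c w : 'I_N -> 'cV[R]_p) (S : 'I_N -> 'M[R]_p) (f : 'I_N -> R) :
  lower_tri_rep L c S w f -> (forall i, f i != 0) ->
  (forall i : 'I_N, (i.+1 < N)%N -> elim_mx c w f i \in unitmx) ->
  L \in unitmx /\
  lower_tri_rep (invmx L) (c_bar c f) (fun i => S i *m elim_mx c w f i)
    (w_bar c w f) (f_bar f).
Proof.
move=> [/is_trig_mxP Ltrig Llow Ldiag] f0 Eunit.
set Sb := fun i => _.
pose y (i j : 'I_N) := dec_prod Sb i j *m w_bar c w f j.
pose M : 'M[R]_N := \matrix_(i, j)
  if (j < i)%N then ((c_bar c f i)^T *m y i j) 0 0
  else if i == j then (f i)^-1 else 0.
have Mlow (i j : 'I_N) : (j < i)%N ->
    M i j = - ((f i)^-1 * ((c i)^T *m y i j) 0 0).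
  by move=> ji; rewrite mxE ji /c_bar linearZ /= -scalemxAl mxE mulNr.
have Mdiag (j : 'I_N) : M j j = (f j)^-1 by rewrite mxE ltnn eqxx.
have Mup (i j : 'I_N) : (i < j)%N -> M i j = 0.
  by move=> ij; rewrite mxE -val_eqE /=; case: ltngtP ij.
pose x (i j : 'I_N) :=
  \sum_(k < N | (k < i)%N) M k j *: (dec_prod S i k *m w k).
have xS (i i' j : 'I_N) : i' = i.+1 :> nat ->
    x i' j = S i *m (x i j + M i j *: w i).
  move=> i'E; rewrite /x (bigD1 i) /= ?i'E //.
  rewrite (dec_prodS S i'E (leqnn i)) dec_prod_id mulmx1 addrC mulmxDr.
  rewrite mulmx_sumr.
  congr (_ + _); last by rewrite scalemxAr.
  apply: eq_big => [k|k /andP[ki _]].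
    by rewrite ltnS -val_eqE /= andbC ltn_neqAle.
  by rewrite (dec_prodS S i'E) // -scalemxAr mulmxA.
have x0 (i j : 'I_N) : (i <= j)%N -> x i j = 0.
  move=> ij; rewrite /x big1 // => k ki.
  by rewrite Mup ?scale0r //; apply: leq_trans ij.
have xE (i j : 'I_N) : (j < i)%N -> x i j = y i j.
  (* Induction on the value of [i]; its predecessor is rebuilt as the ordinal [i0]. *)
  move: {2}(i : nat) (erefl (i : nat)) => m; elim: m i => [|m IH] i im.
    by rewrite im.
  have mN : (m < N)%N by rewrite -ltnS -im; apply: leq_trans (ltn_ord i) _.
  rewrite im ltnS => jm; pose i0 := Ordinal mN.
  rewrite (xS i0) // /y (dec_prodS Sb (i := i0)) // /Sb -/Sb -!mulmxA.
  congr (_ *m _).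
  move: jm; rewrite leq_eqVlt => /orP[/eqP jm|jm].
    (* Start of the recursion, [i = j + 1]: the last factor of the product in [y i j] brings in
       [elim_mx] at [j], which the inverse inside [w_bar] cancels. *)
    have -> : i0 = j by apply: val_inj.
    rewrite x0 // add0r Mdiag dec_prod_id mul1mx /w_bar -scalemxAr mulKVmx //.
    by apply: Eunit; rewrite jm -im.
  rewrite (IH i0) // Mlow // -/(y i0 j) /elim_mx mulmxBl mul1mx.
  by rewrite -mulmxA mulmx_col11 -scalemxAl scaleNr [X in _ = _ - X *: _]mxE.
have LM : L *m M = 1%:M.
  apply/matrixP => i j; rewrite !mxE (bigID (fun k : 'I_N => (k < i)%N)) /=.
  rewrite [X in _ + X](bigD1 i) /= ?ltnn //.
  rewrite [X in _ + (_ + X)]big1 ?addr0; last first.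
    move=> k /andP[ki nki]; rewrite Ltrig ?mul0r //.
    by rewrite ltn_neqAle leqNgt ki andbT eq_sym.
  (* The strictly lower part of row [i] of [L] sees column [j] of [M] only through the state
     [x i j]. *)
  have -> : \sum_(k < N | (k < i)%N) L i k * M k j = ((c i)^T *m x i j) 0 0.
    rewrite /x mulmx_sumr summxE; apply: eq_bigr => k ki.
    by rewrite Llow // -scalemxAr mulmxA [RHS]mxE mulrC.
  rewrite Ldiag -val_eqE /=; case: (ltngtP i j) => ij.
  - by rewrite x0 ?(ltnW ij) // mulmx0 mxE Mup // mulr0 addr0.
  - by rewrite xE // Mlow // mulrN mulVKf // subrr.
  - by rewrite x0 ?ij // mulmx0 mxE (val_inj ij) Mdiag add0r mulfV.
have [Lu _] := mulmx1_unit LM; split=> //.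
have -> : invmx L = M by rewrite -[M](mulKmx Lu) LM mulmx1.
split=> [|i j ji|i].
- by apply/is_trig_mxP => i j; apply: Mup.
- by rewrite mxE ji mulmxA.
- exact: Mdiag.
Qed.

Theorem theorem4p3 (R : realType) (N p : nat) (A L : 'M[R]_N)
    (c s nu w : 'I_N -> 'cV[R]_p) (d f : 'I_N -> R) (P : 'I_N -> 'M[R]_p)
    (hA : semiseparable p A)
    (hGvR : givens_vector_rep A c s nu)
    (hpos : posdefmx (A + diag_mx (\row_i d i)))
    (hL : cholesky_factor (A + diag_mx (\row_i d i)) L)
    (hrec : cholesky_recursion c s nu d f w P)
    (hLrep : lower_tri_rep L c (diag_of s) w f)
    (hf : forall i : 'I_N, 0 < f i)
    (hd : forall i : 'I_N, 0 < d i) :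
  [/\ L \in unitmx,
      forall i : 'I_N, f i != 0,
      forall i : 'I_N, (i.+1 < N)%N -> elim_mx c w f i \in unitmx
    & lower_tri_rep (invmx L) (c_bar c f) (S_bar c s w f) (w_bar c w f)
        (f_bar f)].
Proof.
have f0 i : f i != 0 by rewrite gt_eqF.
have Eunit (i : 'I_N) : (i.+1 < N)%N -> elim_mx c w f i \in unitmx.
  move=> iN; have [_ _ fE wE] := hrec.
  have -> : elim_mx c w f i = 1%:M - w i *m ((f i)^-1 *: c i)^T.
    by rewrite linearZ.
  apply: unitmx_sub_rank1; rewrite linearZ /= -scalemxAl mxE.
  have nuE : nu i - P i *m c i = f i *: w i.
    by rewrite wE // scalerA mulfV ?scale1r.
  (* [Num.sqrt] vanishes on nonpositive arguments, so [0 < f i] makes the radicand positive, and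
     squaring recovers it. *)
  have := hf i; rewrite {1}fE sqrtr_gt0 => /ltW/sqr_sqrtr.
  rewrite -fE nuE -scalemxAr mxE => f2.
  (* If [f_i^{-1} c_i^T w_i] were 1, then [f_i^2 = f_i^2 + d_i], contradicting [d_i > 0]. *)
  apply/eqP => cw; have cwf : ((c i)^T *m w i) 0 0 = f i.
    by rewrite -[LHS](mulVKf (f0 i)) cw mulr1.
  move: f2; rewrite cwf expr2 => /eqP.
  by rewrite -subr_eq0 opprD addNKr oppr_eq0 gt_eqF.
have [Lu Linv] := lower_tri_rep_inv hLrep f0 Eunit.
by split.
Qed.
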